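(* Let $E$ be a Banach space and $F$ be a subspace of $E$. (1) If $E$ is almost finitely isometrically extensible and $F$ is $1$-complemented in $E$, then $F$ is almost finitely isometrically extensible. (2) If $E$ is almost finitely isometrically extensible and $F$ is $1$-complemented in $E^{**}$ (with $F\subseteq E\subseteq E^{**}$ canonically), then $F$ is finitely isometrically extensible. In particular, every reflexive almost finitely isometrically extensible Banach space is finitely isometrically extensible.
   Context: $\mathrm{Age}(E)$ is the set of finite-dimensional subspaces of $E$ and $\mathrm{Emb}(X,E)$ is the set of linear isometries (not necessarily onto) from $X$ into $E$. A Banach space $E$ is finitely isometrically extensible (FIE) if for all $X\in\mathrm{Age}(E)$ and all $\phi\in\mathrm{Emb}(X,E)$ there is a norm-one operator from $E$ to $E$ which extends $\phi$. A Banach space $E$ is almost finitely isometrically extensible (aFIE) if for all $\varepsilon>0$, all $X\in\mathrm{Age}(E)$ and all $\phi\in\mathrm{Emb}(X,E)$ there exists an operator $T\colon E\to E$ with $T|_X=\phi$ and $\|T\|\le 1+\varepsilon$. A subspace is $1$-complemented if it is the range of a norm-one projection defined on the larger space. *)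

(* Defs.v *)
From HB Require Import structures.
From mathcomp Require Import all_boot all_order all_algebra.
From mathcomp Require Import all_classical all_reals all_analysis.
From mathcomp Require Import complex.

Set Implicit Arguments.
Unset Strict Implicit.
Unset Printing Implicit Defensive.

Import Order.TTheory GRing.Theory Num.Theory.
Import numFieldNormedType.Exports.

Local Open Scope classical_set_scope.
Local Open Scope ring_scope.

(* Banach spaces may be real or complex. *)
Variant scalars := RealScalars | ComplexScalars.

Definition scalar_field (R : realType) (k : scalars) : numFieldType :=
  match k with
  | RealScalars => R
  | ComplexScalars => complex R
  end.

Lemma scalar_sup (R : realType) (k : scalars) (A : set (scalar_field R k)) :
  A !=set0 -> has_ubound A -> (forall a, A a -> 0 <= a) -> supremums A !=set0.
Proof.
case: k A => /= A A0 ubA A_ge0.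
  exists (reals.sup A); split; first exact: ub_le_sup.
  by move=> b ubb; exact: ge_sup.
have AE a : A a -> complex.Im a = 0 /\ a = Complex (complex.Re a) 0.
  by move=> /A_ge0; rewrite lecE => /andP[/eqP/= Ia _]; case: a Ia => /= x y ->.
pose B := [set complex.Re a | a in A].
have B0 : B !=set0 by case: A0 => a Aa; exists (complex.Re a), a.
have ubB : has_ubound B.
  case: ubA => b ubb; exists (complex.Re b) => _ [a Aa <-].
  by have := ubb _ Aa; rewrite lecE => /andP[].
exists (Complex (reals.sup B) 0); split.
  move=> a Aa; have [Ia _] := AE _ Aa.
  by rewrite lecE /= Ia eqxx /=; apply: ub_le_sup => //; exists a.
move=> b ubb; case: (A0) => a Aa.
have := ubb _ Aa; have [Ia _] := AE _ Aa.
rewrite !lecE /= Ia => /andP[-> _] /=; apply: ge_sup => // _ [c Ac <-].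
by have := ubb _ Ac; rewrite lecE => /andP[].
Qed.

Section Subspace.
Variables (K : numFieldType) (E : normedModType K) (F : submodClosed E).

Record subspace_of := Subspace_of {
  subspace_val :> E;
  _ : subspace_val \in (F : {pred E}) }.

HB.instance Definition _ := [isSub for subspace_val].
HB.instance Definition _ := [Choice of subspace_of by <:].
HB.instance Definition _ := [SubChoice_isSubLmodule of subspace_of by <:].

Let subnorm (x : subspace_of) : K := `|val x|.

Let subnormD x y : subnorm (x + y) <= subnorm x + subnorm y.
Proof. by rewrite /subnorm raddfD ler_normD. Qed.

Let subnormZ (l : K) x : subnorm (l *: x) = `|l| * subnorm x.
Proof. by rewrite /subnorm linearZ normrZ. Qed.

Let subnorm0_eq0 x : subnorm x = 0 -> x = 0.
Proof. by move=> /normr0_eq0 x0; apply: val_inj; rewrite x0 raddf0. Qed.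

HB.instance Definition _ :=
  Lmodule_isNormed.Build K subspace_of subnormD subnormZ subnorm0_eq0.

End Subspace.

Section BoundedOperators.
Variables (R : realType) (k : scalars).
Local Notation K := (scalar_field R k).
Variables (E F : normedModType K).

Definition operator_pred : {pred E -> F} :=
  [pred f : E -> F | `[< linear f /\ continuous f >]].

Lemma operator_submod_closed : submod_closed operator_pred.
Proof.
split=> [|a f g /asboolP[lf cf] /asboolP[lg cg]]; apply/asboolP; split.
- by move=> a x y; rewrite /= scaler0 addr0.
- by move=> x; exact: cvg_cst.
- move=> b x y; rewrite !fctE lf lg !scalerDr !scalerA (mulrC a) -!addrA.
  by congr (_ + _); rewrite addrCA.
- move=> x; apply: cvgD; last exact: cg.
  by apply: cvgZr; exact: cf.
Qed.

HB.instance Definition _ :=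
  GRing.isSubmodClosed.Build K (E -> F) operator_pred operator_submod_closed.

Record operator := Operator {
  operator_fun :> E -> F;
  _ : operator_fun \in operator_pred }.

HB.instance Definition _ := [isSub for operator_fun].
HB.instance Definition _ := [Choice of operator by <:].
HB.instance Definition _ := [SubChoice_isSubLmodule of operator by <:].

Lemma operator_linear (T : operator) : linear T.
Proof. by case: T => f /= /asboolP[]. Qed.

Lemma operator_continuous (T : operator) : continuous T.
Proof. by case: T => f /= /asboolP[]. Qed.

HB.instance Definition _ (T : operator) :=
  GRing.isLinear.Build K E F *:%R T (operator_linear T).

(* For complex scalars the order of [R[i]] is partial, but the set below
   consists of nonnegative reals and has a supremum by [scalar_sup]. *)
Definition opnorm (T : operator) : K :=
  supremum 0 [set `|T x| | x in [set x : E | `|x| <= 1]].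

Lemma opnorm_lub (T : operator) :
  supremums [set `|T x| | x in [set x : E | `|x| <= 1]] (opnorm T).
Proof.
set A := [set _ | _ in _].
have A0 : A !=set0 by exists `|T 0|, 0 => //=; rewrite normr0.
rewrite /opnorm /supremum -/A ifF; last exact/negP/negP/set0P.
have [c cA] : supremums A !=set0; last by case: xgetP => // /(_ _ cA).
apply: scalar_sup => //; last by move=> _ [x _ <-].
have /linear_bounded_continuous/linear_boundedP : continuous T.
  exact: operator_continuous.
move=> /pinfty_ex_gt0[M M0 TM]; exists M => _ [x /= x1 <-].
by rewrite (le_trans (TM x))// ler_piMr// ltW.
Qed.

Lemma opnorm_ge0 (T : operator) : 0 <= opnorm T.
Proof.
have [ub _] := opnorm_lub T; apply: ub.
by exists 0; rewrite /= ?normr0// linear0 normr0.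
Qed.

Lemma opnorm_le (T : operator) (x : E) : `|T x| <= opnorm T * `|x|.
Proof.
have [->|x0] := eqVneq x 0; first by rewrite linear0 !normr0 mulr0.
have [ub _] := opnorm_lub T.
rewrite -ler_pdivrMr ?normr_gt0//; apply: ub.
exists (`|x|^-1 *: x); first by rewrite /= normfZV.
by rewrite linearZ normrZ mulrC normfV normr_id.
Qed.

Lemma opnorm_le_bound (T : operator) (c : K) :
  0 <= c -> (forall x, `|T x| <= c * `|x|) -> opnorm T <= c.
Proof.
move=> c0 Tc; have [_ lub] := opnorm_lub T.
apply: lub => _ [x /= x1 <-].
by rewrite (le_trans (Tc x))// ler_piMr.
Qed.

Let opnormD S T : opnorm (S + T) <= opnorm S + opnorm T.
Proof.
apply: opnorm_le_bound => [|x]; first by rewrite addr_ge0 ?opnorm_ge0.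
by rewrite mulrDl (le_trans (ler_normD _ _))// lerD ?opnorm_le.
Qed.

Let opnormZ_le (l : K) T : opnorm (l *: T) <= `|l| * opnorm T.
Proof.
apply: opnorm_le_bound => [|x]; first by rewrite mulr_ge0 ?opnorm_ge0.
by rewrite [(l *: T) x]/(l *: T x) normrZ -mulrA ler_wpM2l ?opnorm_le.
Qed.

Let opnormZ (l : K) T : opnorm (l *: T) = `|l| * opnorm T.
Proof.
apply/eqP; rewrite eq_le opnormZ_le /=.
have [->|l0] := eqVneq l 0; first by rewrite normr0 mul0r opnorm_ge0.
rewrite -ler_pdivlMl ?normr_gt0// -normfV.
by rewrite -{1}(scalerK l0 T) opnormZ_le.
Qed.

Let opnorm0_eq0 T : opnorm T = 0 -> T = 0.
Proof.
move=> T0; apply: val_inj; apply/funext => x /=.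
by apply/normr0_eq0/le_anti; rewrite normr_ge0 -[leRHS](mul0r `|x|) -T0 opnorm_le.
Qed.

HB.instance Definition _ :=
  Lmodule_isNormed.Build K operator opnormD opnormZ opnorm0_eq0.

End BoundedOperators.

Section Bidual.
Variables (R : realType) (k : scalars).
Local Notation K := (scalar_field R k).

Definition dual (E : normedModType K) : normedModType K := operator E K^o.

Definition bidual (E : normedModType K) : normedModType K := dual (dual E).

Variable E : normedModType K.

Definition evaluation (x : E) (f : dual E) : K^o := (f : operator E K^o) x.

Lemma evaluation_operator (x : E) :
  evaluation x \in @operator_pred R k (dual E) K^o.
Proof.
have lx : linear (evaluation x) by [].
apply/asboolP; split=> //.
pose e : {linear dual E -> K^o} :=
  HB.pack (evaluation x) (GRing.isLinear.Build _ _ _ _ _ lx).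
apply: (bounded_linear_continuous (f := e)); apply/bounded_funP => r.
exists (r * `|x|) => f fr; rewrite (le_trans (opnorm_le f x))//.
by rewrite ler_wpM2r.
Qed.

Definition canonical_embedding (x : E) : bidual E :=
  Operator (evaluation_operator x).

Definition reflexive_space := range canonical_embedding = setT.

End Bidual.

Section Extensibility.
Variables (R : realType) (k : scalars).
Local Notation K := (scalar_field R k).

Definition finite_dimensional (E : normedModType K) (X : submodClosed E) :=
  exists (n : nat) (b : 'I_n -> E), forall x : E,
    x \in X <-> exists c : 'I_n -> K, x = \sum_(i < n) c i *: b i.

Definition linear_isometry (E F : normedModType K) (phi : {linear E -> F}) :=
  forall x, `|phi x| = `|x|.

(* Stated for normed modules so that they apply to a linear subspace not assumed
   to be closed; a 1-complemented subspace of a Banach space is automatically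
   closed.  For complex scalars [0 < eps] forces [eps] to be real.
   On the zero space no operator has norm one; we adopt the usual convention
   that it is nevertheless finitely isometrically extensible, and that the
   zero subspace is 1-complemented. *)
Definition FIE (E : normedModType K) :=
  forall (X : submodClosed E) (phi : {linear subspace_of X -> E}),
    finite_dimensional X -> linear_isometry phi ->
    exists T : operator E E,
      (forall x : subspace_of X, T (val x) = phi x) /\
      (`|T| = 1 \/ [set: E] = [set 0]).

Definition aFIE (E : normedModType K) :=
  forall (eps : K) (X : submodClosed E) (phi : {linear subspace_of X -> E}),
    0 < eps -> finite_dimensional X -> linear_isometry phi ->
    exists T : operator E E,
      (forall x : subspace_of X, T (val x) = phi x) /\ `|T| <= 1 + eps.

Definition one_complemented (V : normedModType K) (G : set V) :=
  exists P : operator V V,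
    [/\ forall v, P (P v) = P v, range P = G & `|P| = 1 \/ G = [set 0]].

End Extensibility.

(* Main.v *)
Require Import Defs.
From HB Require Import structures.
From mathcomp Require Import all_boot all_order all_algebra.
From mathcomp Require Import all_classical all_reals all_analysis.
From mathcomp Require Import complex ring.

Set Implicit Arguments.
Unset Strict Implicit.
Unset Printing Implicit Defensive.

Import Order.TTheory GRing.Theory Num.Theory.
Import numFieldNormedType.Exports.
Local Open Scope classical_set_scope.
Local Open Scope ring_scope.

(* Push a finite-dimensional isometry of F into E by the inclusion j, extend it
   by almost extensibility to operators T_e from F to E of norm at most 1 + e,
   and come back to F with the given projection.  For (1) one T_e is enough.
   For (2), let e tend to 0 along an ultrafilter: x |-> weak*-lim J (T_e x),
   with J the canonical embedding of E, is a contraction from F to the bidual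
   of E, whose composition with the projection onto J(F) is an exact extension
   of norm at most 1; the norm is 1 because the operator is isometric on X,
   unless X = 0, where the identity is used instead.  Pulling operators back
   along J requires J to be isometric, hence the Hahn-Banach theorem. *)

(** * Hahn-Banach theorem via minimal sublinear functionals *)

Section HahnBanach.
Variables (R : realType) (K : numFieldType) (i : {rmorphism R -> K}).
Variable V : lmodType K.
Implicit Types (p : V -> R) (x y : V) (s t : R).

Lemma le_mul_inf (A : set R) (c t : R) :
  A !=set0 -> 0 <= t -> (forall a, A a -> c <= t * a) -> c <= t * inf A.
Proof.
move=> A0; rewrite le_eqVlt => /orP[/eqP <-|t0] cA.
  by case: A0 => a /cA; rewrite !mul0r.
rewrite -ler_pdivrMl//; apply: lb_le_inf => // a Aa.
by rewrite ler_pdivrMl// cA.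
Qed.

Lemma le_add_inf (A B : set R) (c : R) : A !=set0 -> B !=set0 ->
  (forall a b, A a -> B b -> c <= a + b) -> c <= inf A + inf B.
Proof.
move=> A0 B0 cAB; rewrite -lerBlDr; apply: lb_le_inf => // a Aa.
rewrite lerBlDr -lerBlDl; apply: lb_le_inf => // b Bb.
by rewrite lerBlDl cAB.
Qed.

(** Real scalars act on [V] through [i], so one real-linear argument serves real and complex spaces
    alike. *)
Definition sublinear p :=
  (forall x y, p (x + y) <= p x + p y) /\
  (forall t x, 0 <= t -> p (i t *: x) <= t * p x).

Lemma sublinear0 p : sublinear p -> p 0 = 0.
Proof.
move=> [pD pZ]; apply/le_anti/andP; split.
  by have := pZ 0 0 (lexx 0); rewrite scaler0 mul0r.
by have := pD 0 0; rewrite addr0 lerDl.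
Qed.

Lemma sublinearZ p t x : sublinear p -> 0 <= t -> p (i t *: x) = t * p x.
Proof.
move=> sp; have [pD pZ] := sp.
rewrite le_eqVlt => /orP[/eqP <-|t0].
  by rewrite rmorph0 scale0r mul0r sublinear0.
apply/le_anti; rewrite pZ ?(ltW t0)//= -ler_pdivlMl//.
have := pZ t^-1 (i t *: x); rewrite scalerA -rmorphM mulVf ?gt_eqF//.
by rewrite rmorph1 scale1r; apply; rewrite invr_ge0 ltW.
Qed.

Lemma sublinear_opp_le p x : sublinear p -> - p (- x) <= p x.
Proof.
move=> sp; have [pD _] := sp.
by rewrite -subr_ge0 opprK -(sublinear0 sp) -(subrr x) pD.
Qed.

(** For sublinear [p], this is the largest sublinear functional below [p] whose value at [- y] is at
    most [- p y]. *)
Definition reduction p y x :=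
  inf [set p (x + i t *: y) - t * p y | t in [set t | 0 <= t]].

Lemma reduction_le p y x t : sublinear p -> 0 <= t ->
  reduction p y x <= p (x + i t *: y) - t * p y.
Proof.
move=> sp t0; apply: ge_inf; last by exists t.
(* Lower bound from [s * p y = p (i s *: y) <= p (x + i s *: y) + p (- x)]. *)
exists (- p (- x)) => _ [s /= s0 <-].
rewrite -(sublinearZ _ sp s0) lerBrDr addrC lerBlDr addrC.
have [pD _] := sp.
by rewrite addrC (le_trans _ (pD _ _))// addrAC subrr add0r.
Qed.

Lemma reduction_id p y x : sublinear p -> reduction p y x <= p x.
Proof.
move=> sp; have := reduction_le y x sp (lexx 0).
by rewrite rmorph0 scale0r addr0 mul0r subr0.
Qed.

Lemma reduction_opp p y : sublinear p -> reduction p y (- y) <= - p y.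
Proof.
move=> sp; have := reduction_le y (- y) sp ler01.
by rewrite rmorph1 scale1r addNr mul1r sublinear0// sub0r.
Qed.

(** Parameters [s] for [x] and [t] for [z] combine to [s + t] for [x + z]; scaling [x] by [t] scales
    its parameter by [t]. *)
Lemma reduction_sublinear p y : sublinear p -> sublinear (reduction p y).
Proof.
move=> sp; have [pD pZ] := sp.
split=> [x z|t x t0].
  apply: le_add_inf; [by exists (p (x + i 0 *: y) - 0 * p y), 0 => /=|
                      by exists (p (z + i 0 *: y) - 0 * p y), 0 => /=|].
  move=> _ _ [s /= s0 <-] [t /= t0 <-].
  apply: (le_trans (reduction_le _ _ sp (addr_ge0 s0 t0))).
  by rewrite mulrDl addrACA -opprD lerB// rmorphD scalerDl addrACA pD.
apply: le_mul_inf => //; first by exists (p (x + i 0 *: y) - 0 * p y), 0 => /=.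
move=> _ [s /= s0 <-].
apply: (le_trans (reduction_le _ _ sp (mulr_ge0 t0 s0))).
by rewrite mulrBr mulrA lerB// rmorphM -scalerA -scalerDr pZ.
Qed.

(** Zorn's lemma for the reversed pointwise order. A nonempty chain is bounded by its pointwise
    infimum, which is subadditive because any two members of the chain are comparable. *)
Lemma exists_minimal_sublinear p : sublinear p ->
  exists2 q, sublinear q /\ (forall x, q x <= p x) &
    forall r, sublinear r -> (forall x, r x <= q x) -> r = q.
Proof.
move=> sp.
pose T := {q | sublinear q /\ forall x, q x <= p x}.
pose below (q r : T) := `[< forall x, sval r x <= sval q x >].
have [| | | |[q [sq qp]] qmin] := @Zorn T below.
- by move=> q; apply/asboolP.
- move=> q r s /asboolP qr /asboolP rs; apply/asboolP => x.
  exact: le_trans (rs x) (qr x).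
- move=> [q Hq] [r Hr] /asboolP/= qr /asboolP/= rq; apply: eq_sig_hprop => /=.
    by move=> x ? ?; exact: Prop_irrelevance.
  by apply/funext => x; apply/le_anti; rewrite qr rq.
- move=> A Atot; have [A0|A0] := pselect (A !=set0); last first.
    by exists (exist _ p (conj sp (fun=> lexx _))) => q Aq; case: A0; exists q.
  pose S x := [set sval q x | q in A].
  have S0 x : S x !=set0 by case: A0 => q Aq; exists (sval q x), q.
  have infS (q : T) x : A q -> inf (S x) <= sval q x.
    move=> Aq; apply: ge_inf; last by exists q.
    (* This lower bound is uniform over the chain: [- p (- x) <= - r (- x) <= r x]. *)
    exists (- p (- x)) => _ [r Ar <-]; have [sr rp] := svalP r.
    by rewrite (le_trans _ (sublinear_opp_le x sr))// lerN2.
  have sinf : sublinear (fun x => inf (S x)).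
    split=> [x y|t x t0]; [apply: le_add_inf|apply: le_mul_inf] => //.
      move=> _ _ [q Aq <-] [r Ar <-].
      have [/asboolP rq|/asboolP qr] := Atot _ _ Aq Ar.
        rewrite (le_trans (infS r _ Ar))//.
        by rewrite (le_trans ((svalP r).1.1 _ _))// lerD.
      rewrite (le_trans (infS q _ Aq))//.
      by rewrite (le_trans ((svalP q).1.1 _ _))// lerD.
    move=> _ [q Aq <-]; rewrite (le_trans (infS q _ Aq))//.
    exact: (svalP q).1.2.
  have infp x : inf (S x) <= p x.
    by case: A0 => q Aq; rewrite (le_trans (infS q _ Aq))//; case: (svalP q).
  exists (exist _ (fun x => inf (S x)) (conj sinf infp)) => q Aq.
  by apply/asboolP => x; exact: infS.
exists q => // r sr rq.
have rp x : r x <= p x by rewrite (le_trans (rq x)).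
by apply: (congr1 sval (qmin (exist _ r (conj sr rp)) _)); exact/asboolP.
Qed.

(* A minimal sublinear functional q equals all its reductions, hence
   q (- y) <= - q y for every y, which makes it odd and therefore linear. *)
Lemma exists_linear_below p : sublinear p ->
  exists f : V -> R, [/\ forall x y, f (x + y) = f x + f y,
    forall t x, f (i t *: x) = t * f x & forall x, f x <= p x].
Proof.
move=> /exists_minimal_sublinear[q [sq qp] qmin]; exists q; have [qD _] := sq.
have qN x : q (- x) = - q x.
  apply/le_anti/andP; split; last by rewrite lerNl sublinear_opp_le.
  have := reduction_opp x sq; rewrite (qmin (reduction q x))//.
    exact: reduction_sublinear.
  by move=> y; exact: reduction_id.
split=> // [x y|t x].
  apply/le_anti; rewrite qD/=.
  by have := qD (- x) (- y); rewrite -opprD !qN -opprD lerN2.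
have [t0|/ltW t0] := leP 0 t; first exact: sublinearZ.
rewrite -[in LHS](opprK t) rmorphN scaleNr qN sublinearZ ?oppr_ge0//.
by rewrite mulNr opprK.
Qed.

(** A linear [f] below [reduction p y] satisfies [- f y = f (- y) <= - p y], which forces equality
    at [y]. *)
Lemma exists_norming_below p y : sublinear p ->
  exists f : V -> R, [/\ forall x z, f (x + z) = f x + f z,
    forall t x, f (i t *: x) = t * f x, forall x, f x <= p x & f y = p y].
Proof.
move=> sp.
have [f [fD fZ fp]] := exists_linear_below (reduction_sublinear y sp).
have fp' x : f x <= p x by rewrite (le_trans (fp x)) ?reduction_id.
exists f; split=> //; apply/le_anti; rewrite fp'/=.
have := le_trans (fp (- y)) (reduction_opp y sp).
by rewrite -[- y]scaleN1r -(rmorph1 i) -rmorphN fZ mulN1r lerN2.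
Qed.

End HahnBanach.

(** * Bounded operators and norming functionals *)

Section Operators.
Variables (R : realType) (k : scalars).
Local Notation K := (scalar_field R k).

Lemma operator_of_bound (E F : normedModType K) (f : E -> F) (c : K) :
  linear f -> 0 <= c -> (forall x, `|f x| <= c * `|x|) ->
  exists T : operator E F, T = f :> (E -> F) /\ `|T| <= c.
Proof.
move=> lf c0 fc.
pose g : {linear E -> F} := HB.pack f (GRing.isLinear.Build _ _ _ _ f lf).
have fop : f \in @operator_pred R k E F.
  apply/asboolP; split=> //; apply: (bounded_linear_continuous (f := g)).
  apply/bounded_funP => r; exists (c * r) => x xr.
  by rewrite (le_trans (fc x))// ler_wpM2l.
by exists (Operator fop); split=> //; exact: opnorm_le_bound.
Qed.

Lemma operator_comp (E F G : normedModType K) (S : operator F G)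
    (T : operator E F) : exists ST : operator E G,
  (forall x, ST x = S (T x)) /\ `|ST| <= `|S| * `|T|.
Proof.
have lST : linear (S \o T) by move=> a x y; rewrite /= !linearP.
have [|x|U [UE Ule]] := operator_of_bound lST (c := `|S| * `|T|).
- by rewrite mulr_ge0.
- apply: (le_trans (opnorm_le S _)).
  by rewrite -mulrA ler_wpM2l//; [exact: opnorm_ge0|exact: opnorm_le].
by exists U; split=> // x; rewrite UE.
Qed.

End Operators.

Lemma norming_functional (R : realType) (k : scalars)
    (E : normedModType (scalar_field R k)) (y : E) :
  exists f : dual E, `|f| <= 1 /\ `|y| <= `|(f : operator E _) y|.
Proof.
case: k E y => /= E y.
  have sN : sublinear idfun (fun x : E => `|x|).
    split=> [x z|t x t0]; first exact: ler_normD.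
    by rewrite normrZ ger0_norm.
  have [g [gD gZ gle gy]] := exists_norming_below y sN.
  have lg : linear (g : E -> R^o) by move=> a x z; rewrite gD gZ.
  have [x|f [fE f1]] :=
    @operator_of_bound R RealScalars E R^o g 1 lg ler01.
    rewrite mul1r ler_norml gle andbT lerNl -(mul1r (g x)) -mulNr -gZ scaleN1r.
    by rewrite -normrN gle.
  by exists f; split=> //; rewrite fE gy ler_norm.
(* The norm takes values in [R[i]] but is real; its real part is the [R]-valued sublinear functional
   to dominate. *)
have normE (x : E) : `|x| = (complex.Re `|x|)%:C%C.
  have := normr_ge0 x; rewrite lecE => /andP[/eqP/= + _].
  by case: `|x| => a b /= ->.
have Re_le (a b : R[i]%C) : a <= b -> complex.Re a <= complex.Re b.
  by rewrite lecE => /andP[].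
have sN : sublinear (real_complex R) (fun x : E => complex.Re `|x|).
  split=> [x z|t x t0].
    apply: le_trans (Re_le _ _ (ler_normD x z)) _.
    by rewrite (raddfD (@complex.Re R : Rcomplex R -> R)).
  by rewrite normrZ normE ger0_norm ?ler0c// -rmorphM.
have [g [gD gZ gle gy]] := exists_norming_below y sN.
(* The only complex-linear functional with real part [g]. *)
pose h (x : E) : R[i]^o := Complex (g x) (- g ('i%C *: x)).
have gZC (a : R[i]%C) x :
    g (a *: x) = complex.Re a * g x + complex.Im a * g ('i%C *: x).
  by rewrite {1}(complexE a) mulrC scalerDl gD -scalerA !gZ.
have lh : linear h.
  move=> a x z; rewrite /h scalerDr !gD scalerA (mulrC 'i%C) -scalerA.
  rewrite !(gZC a) scalerA -expr2 sqr_i.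
  have -> : g (- 1 *: x) = - g x.
    by rewrite -(rmorph1 (real_complex R)) -rmorphN gZ mulN1r.
  case: a => a b; apply/eqP; rewrite eq_complex/=; apply/andP; split; apply/eqP.
    by rewrite mulrN opprK.
  by rewrite mulrN; ring.
have hle x : `|h x| <= 1 * `|x|.
  rewrite mul1r; have [->|hx0] := eqVneq (h x) 0; first by rewrite normr0.
  (* The unimodular [u] rotates [h x] onto the positive real axis, so the modulus of [h x] equals
     [g (u *: x)], which the norm of [u *: x], that is of [x], dominates. *)
  pose u := `|h x| / h x.
  have uh : h (u *: x) = `|h x|.
    have -> : h (u *: x) = u * h x.
      exact: (GRing.scalable_linear lh).
    by rewrite /u mulfVK.
  have u1 : `|u| = 1 by rewrite normf_div normr_id divff// normr_eq0.
  have -> : `|x| = `|u *: x| by rewrite normrZ u1 mul1r.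
  rewrite (normE (u *: x)) -uh lecE gle andbT/=.
  have : 0 <= h (u *: x) by rewrite uh.
  by rewrite lecE => /andP[/eqP/= -> _].
have [f [fE f1]] :=
  @operator_of_bound R ComplexScalars E R[i]^o h 1 lh ler01 hle.
exists f; split=> //; rewrite fE normE -gy.
by apply: le_trans (normc_ge_Re (h y)); rewrite lecR ler_norm.
Qed.

(** * The canonical embedding into the bidual *)

Section CanonicalEmbedding.
Variables (R : realType) (k : scalars).
Local Notation K := (scalar_field R k).
Variable E : normedModType K.

Lemma canonical_embedding_linear : linear (@canonical_embedding R k E).
Proof.
move=> a x y; apply: val_inj; apply/funext => f.
exact: (operator_linear (f : operator E _)).
Qed.

(** The operator norm of functionals gives one inequality, a norming functional at [x] the other. *)
Lemma canonical_embedding_isometry (x : E) : `|canonical_embedding x| = `|x|.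
Proof.
apply/le_anti/andP; split.
  apply: opnorm_le_bound => // f; rewrite mulrC.
  exact: (opnorm_le (f : operator E _)).
have [f [f1 fx]] := norming_functional x.
apply: (le_trans fx); apply: (le_trans (opnorm_le (canonical_embedding x) f)).
by rewrite ler_piMr// opnorm_ge0.
Qed.

Lemma canonical_embedding_inj : injective (@canonical_embedding R k E).
Proof.
move=> x y xy; apply/eqP; rewrite -subr_eq0 -normr_eq0.
rewrite -canonical_embedding_isometry -scaleN1r addrC.
by rewrite canonical_embedding_linear xy scaleN1r addNr normr0.
Qed.

End CanonicalEmbedding.

(** * Convergence along ultrafilters *)

Lemma ultra_cvg_compact (I : Type) (T : topologicalType) (U : set_system I)
    (a : I -> T) (A : set T) : UltraFilter U -> compact A ->
  (\forall n \near U, A (a n)) -> exists l : T, a @ U --> l.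
Proof.
move=> UU cA Aa; have [//|l [_ lU]] := cA (a @ U) _.
exists l => N lN.
(* The ultrafilter contains the preimage of [N] or its complement; the latter contradicts that [l]
   is a cluster point. *)
have [//|UN] := in_ultra_setVsetC (a @^-1` N) UU.
by have [x [/= nNx Nx]] := lU (~` N) N UN lN.
Qed.

(** Closed bounded intervals are compact; in the complex case real and imaginary parts converge
    separately. *)
Lemma ultra_cvg_bounded (R : realType) (k : scalars) (I : Type)
    (U : set_system I) (a : I -> scalar_field R k) (M : scalar_field R k) :
  UltraFilter U -> (\forall n \near U, `|a n| <= M) ->
  exists l : (scalar_field R k)^o, (a : I -> (scalar_field R k)^o) @ U --> l.
Proof.
move=> UU; case: k a M => /= a M aM.
  apply: (ultra_cvg_compact UU (@segment_compact R (- M) M)).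
  by apply: filterS aM => n; rewrite /= in_itv/= -ler_norml.
have bd (f : R[i]%C -> R) : (forall z, `|f z|%:C%C <= `|z|) ->
    exists l : R, (f \o a) @ U --> l.
  move=> fle; pose m := complex.Re M.
  apply: (ultra_cvg_compact UU (@segment_compact R (- m) m)).
  apply: filterS aM => n anM; rewrite /= in_itv/= -ler_norml.
  by have := le_trans (fle (a n)) anM; rewrite lecE => /andP[].
have [|x ax] := bd (@complex.Re R); first exact: normc_ge_Re.
have [|y ay] := bd (@complex.Im R).
  move=> [z1 z2]; simpc; rewrite -sqrtr_sqr.
  by rewrite ler_wsqrtr// lerDr sqr_ge0.
exists (Complex x y); apply/cvgrPdist_le => e e0.
(* A positive [e] of [R[i]] is real, so half its real part is the tolerance for each coordinate. *)
pose d := complex.Re e / 2.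
have dE : d%:C%C + d%:C%C = e.
  rewrite -rmorphD -splitr.
  by move: e0; case: (e) => e1 e2; rewrite ltcE/= => /andP[/eqP ->].
have d0 : 0 < d by rewrite divr_gt0//; move: e0; rewrite ltcE => /andP[].
near=> n.
have -> : Complex x y - a n = (x - complex.Re (a n))%:C%C
    + 'i%C * (y - complex.Im (a n))%:C%C.
  by case: (a n) => a1 a2; simpc.
have real_norm (t : R) : `|t%:C%C| = `|t|%:C%C.
  by simpc; rewrite expr0n/= addr0 sqrtr_sqr.
have norm_i : `|'i%C : R[i]%C| = 1.
  by simpc; rewrite expr0n/= add0r expr1n sqrtr1.
rewrite -dE (le_trans (ler_normD _ _))// normrM norm_i mul1r !real_norm.
rewrite lerD// lecR; near: n.
  by move/cvgrPdist_le : ax => /(_ _ d0).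
by move/cvgrPdist_le : ay => /(_ _ d0).
Unshelve. all: by end_near. Qed.

(** * Weak-star limits of operators along an ultrafilter *)

Section WeakStarLimit.
Variables (R : realType) (k : scalars).
Local Notation K := (scalar_field R k).
Variables G E : normedModType K.

(* The ultrafilter refines 0^'+ in K rather than oo in nat, so that no
   archimedean property of the scalars is needed. *)
Lemma weak_star_limit (T : K -> operator G E) :
  (forall e, 0 < e -> `|T e| <= 1 + e) ->
  exists L : operator G (bidual E), `|L| <= 1 /\
    forall x y, (forall e, 0 < e -> T e x = y) -> L x = canonical_embedding y.
Proof.
move=> T1.
have [U [UU U0]] := ultraFilterLemma (at_right_proper_filter (0 : K)).
have Upos : \forall e \near U, 0 < e by apply: U0; exact: nbhs_right_gt.
have Ule (d : K) : 0 < d -> \forall e \near U, `|e| <= d.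
  move=> d0; apply: U0.
  by have := @nbhs0_le K K^o d d0; apply: filterS => e + _.
have ale x (f : dual E) e : 0 < e ->
    `|(f : operator E _) (T e x)| <= (1 + e) * (`|x| * `|f|).
  move=> e0; apply: le_trans (opnorm_le (f : operator E _) _) _.
  rewrite (mulrC `|x|) mulrCA ler_wpM2l//; first exact: opnorm_ge0.
  apply: le_trans (opnorm_le _ _) _.
  by rewrite ler_wpM2r//; exact: T1.
have acvg (xf : G * dual E) : exists l : K^o,
    (fun e => (xf.2 : operator E _) (T e xf.1)) @ U --> l.
  case: xf => x f /=.
  (* Eventually [e <= 1], whence the factor [1 + 1]. *)
  apply: (@ultra_cvg_bounded _ _ _ _ _ ((1 + 1) * (`|x| * `|f|))).
  near=> e.
  have e0 : 0 < e by near: e.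
  apply: (le_trans (ale x f e e0)).
  rewrite ler_wpM2r ?mulr_ge0// lerD2l -(ger0_norm (ltW e0)).
  by near: e; exact: Ule.
have [ell ellP] := choice acvg.
(* Let [e] tend to 0 in [ale]: the approximation error and the excess [e * c] are each made at most
   [d / 2]. *)
have ell_le x f : `|ell (x, f)| <= `|x| * `|f|.
  set c := `|x| * `|f|; have c0 : 0 <= c by rewrite mulr_ge0.
  apply/ler_addgt0Pr => d d0; have d20 : 0 < d / 2 by rewrite divr_gt0.
  have c10 : 0 < c + 1 by rewrite ltr_wpDl.
  near U => e.
  have e0 : 0 < e by near: e.
  have ea : `|ell (x, f) - (f : operator E _) (T e x)| <= d / 2.
    by near: e; have /cvgrPdist_le/(_ _ d20) := ellP (x, f).
  have ec : e * c <= d / 2.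
    (* Dividing by [c + 1] rather than [c] allows [c = 0]. *)
    have : `|e| <= d / 2 / (c + 1).
      near: e. by apply: Ule; rewrite divr_gt0.
    rewrite ger0_norm ?(ltW e0)// ler_pdivlMr//; apply: le_trans.
    by rewrite ler_wpM2l ?(ltW e0)// lerDl.
  rewrite -(subrK ((f : operator E _) (T e x)) (ell (x, f))).
  apply: (le_trans (ler_normD _ _)).
  rewrite [d]splitr addrCA lerD// (le_trans (ale x f e e0))//.
  by rewrite mulrDl mul1r lerD2l.
have ell_linear x : linear (fun f => ell (x, f)).
  move=> a f g; apply: (norm_cvg_unique (ellP (x, a *: f + g))).
  exact: cvgD (cvgZl_tmp (k := a) (ellP (x, f))) (ellP (x, g)).
(* For fixed [x], the limits are linear and bounded in [f], hence form a point of the bidual. *)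
have evT x : exists y : bidual E,
    (forall f, (y : operator _ _) f = ell (x, f)) /\ `|y| <= `|x|.
  have [//|f|y [yE yx]] := operator_of_bound (ell_linear x) (c := `|x|).
  - exact: ell_le.
  by exists y; split=> // f; rewrite yE.
have [lim limP] := choice evT.
have limL : linear lim.
  move=> a x y; apply: val_inj; apply/funext => f.
  transitivity (ell (a *: x + y, f)); first exact: (limP _).1.
  transitivity (a *: ell (x, f) + ell (y, f)); last first.
    by rewrite -(limP x).1 -(limP y).1.
  apply: (norm_cvg_unique (ellP (a *: x + y, f))).
  have TE : (fun e => (f : operator E _) (T e (a *: x + y))) =
      (a \*: (fun e => (f : operator E _) (T e x))) +
      (fun e => (f : operator E _) (T e y)).
    by apply/funext => e; rewrite !linearP.
  rewrite /= TE; exact: cvgD (cvgZl_tmp (k := a) (ellP (x, f))) (ellP (y, f)).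
have [x|L [LE L1]] := operator_of_bound limL ler01.
  by rewrite mul1r; exact: (limP x).2.
exists L; split=> // x y Txy; rewrite LE; apply: val_inj; apply/funext => f.
transitivity (ell (x, f)); first exact: (limP _).1.
apply: (norm_cvg_unique (ellP (x, f))).
(* Positive [e] are eventual along [U], so the family is eventually constant at such an [x]. *)
apply: cvg_near_cst; near=> e.
by rewrite Txy//; near: e.
Unshelve. all: by end_near. Qed.

End WeakStarLimit.

(** * Transport of extensions along isometric embeddings *)

Section IsometricEmbedding.
Variables (R : realType) (k : scalars).
Local Notation K := (scalar_field R k).

Lemma linear_isometry_inj (G E : normedModType K) (j : {linear G -> E}) :
  linear_isometry j -> injective j.
Proof.
move=> jI x y xy; apply/eqP; rewrite -subr_eq0 -normr_eq0 -jI.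
by rewrite linearB xy subrr normr0.
Qed.

(** [S] is [Q] followed by the inverse of [j] on its range: injectivity of [j] makes it linear,
    isometry keeps the bound. *)
Lemma operator_factor (G H E : normedModType K) (j : {linear G -> E})
    (Q : operator H E) : linear_isometry j -> range Q `<=` range j ->
  exists S : operator H G, (forall h, j (S h) = Q h) /\ `|S| <= `|Q|.
Proof.
move=> jI Qj.
have /choice[s sQ] : forall h, exists g, j g = Q h.
  by move=> h; have [|g _ gh] := Qj (Q h); [exists h|exists g].
have ls : linear s.
  by move=> a x y; apply: (linear_isometry_inj jI); rewrite linearP !sQ linearP.
have [||S [SE SQ]] := operator_of_bound ls (c := `|Q|).
- exact: normr_ge0.
- by move=> h; rewrite -jI sQ; exact: opnorm_le.
by exists S; split=> // h; rewrite SE.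
Qed.

Section Image.
Variables (G E : normedModType K) (j : {linear G -> E}) (X : submodClosed G).

Definition image_pred : {pred E} :=
  [pred e | `[< exists x : subspace_of X, j (val x) = e >]].

Lemma image_submod_closed : submod_closed image_pred.
Proof.
split=> [|a _ _ /asboolP[x <-] /asboolP[y <-]]; apply/asboolP.
  by exists 0; rewrite !raddf0.
by exists (a *: x + y); rewrite !linearP.
Qed.

Definition image_submod : submodClosed E := HB.pack image_pred
  (GRing.isSubmodClosed.Build K E image_pred image_submod_closed).

Lemma finite_dimensional_image :
  finite_dimensional X -> finite_dimensional image_submod.
Proof.
move=> [n [b Xb]]; exists n, (j \o b) => e; split.
  move=> /asboolP[x <-]; have /Xb[c ->] : val x \in X by exact: valP.
  by exists c; rewrite linear_sum; apply: eq_bigr => l _; rewrite linearZ.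
move=> [c ->]; apply/asboolP.
have cX : \sum_(l < n) c l *: b l \in X by apply/Xb; exists c.
exists (Subspace_of cX); rewrite /= linear_sum.
by apply: eq_bigr => l _; rewrite linearZ.
Qed.

End Image.

(** The map [phi], conjugated by [j], is an isometry of the image of [X] into [E]; its extension to
    [E] is then precomposed with [j]. *)
Lemma aFIE_extend (E G : normedModType K) (j : {linear G -> E}) :
  linear_isometry j -> aFIE E ->
  forall (eps : K) (X : submodClosed G) (phi : {linear subspace_of X -> G}),
    0 < eps -> finite_dimensional X -> linear_isometry phi ->
  exists T : operator G E,
    (forall x : subspace_of X, T (val x) = j (phi x)) /\ `|T| <= 1 + eps.
Proof.
move=> jI EE eps X phi eps0 fdX phiI.
pose Y := image_submod j X.
have /choice[p pE] (e : subspace_of Y) :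
    exists x : subspace_of X, j (val x) = val e.
  by have /asboolP[x xe] := valP e; exists x.
have lp : linear p.
  move=> a x y; apply/val_inj/(linear_isometry_inj jI).
  by rewrite pE !linearP/= !pE.
pose psi := j \o phi \o p.
have lpsi : linear psi by move=> a x y; rewrite /psi/= lp !linearP.
pose psiL : {linear subspace_of Y -> E} :=
  HB.pack psi (GRing.isLinear.Build _ _ _ _ psi lpsi).
have psiI : linear_isometry psiL.
  by move=> e; rewrite /= /psi/= jI phiI -[RHS]/(`|val e|) -pE jI.
have [T [TE Tle]] := EE eps Y psiL eps0 (finite_dimensional_image j fdX) psiI.
have [g|J [JE J1]] := operator_of_bound (linearP j) (ler01 : 0 <= 1 :> K).
  by rewrite mul1r jI.
have [TJ [TJE TJle]] := operator_comp T J.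
exists TJ; split=> [x|]; last first.
  by apply: (le_trans TJle); apply: le_trans Tle; rewrite ler_piMr.
have xY : j (val x) \in Y by apply/asboolP; exists x.
rewrite TJE JE -[j (val x)]/(val (Subspace_of xY)) TE /= /psi/=.
by do 2!congr (_ _); apply/val_inj/(linear_isometry_inj jI); rewrite pE.
Qed.

(** Idempotence makes [P] the identity on its range, and [A <> [set 0]] excludes the degenerate
    convention. *)
Lemma one_complemented_bound (V : normedModType K) (A : set V) :
  one_complemented A -> A <> [set 0] ->
  exists P : operator V V,
    [/\ `|P| <= 1, range P = A & {in A, forall v, P v = v}].
Proof.
move=> [P [PP rP [P1|//]]] A0; exists P; rewrite P1; split=> // v /set_mem.
by rewrite -rP => -[w _ <-].
Qed.

Lemma extend_trivial (G : normedModType K) (X : submodClosed G)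
    (phi : {linear subspace_of X -> G}) :
  [set: G] = [set 0] ->
  forall x : subspace_of X, (0 : operator G G) (val x) = phi x.
Proof.
by move=> G0 x; have : [set: G] (phi x) by []; rewrite G0 => ->.
Qed.

Lemma range_isometry_trivial (G E : normedModType K) (j : {linear G -> E}) :
  linear_isometry j -> range j = [set 0] -> [set: G] = [set 0].
Proof.
move=> jI j0; apply/seteqP; split=> // g _; apply: (linear_isometry_inj jI).
by rewrite linear0 -[_ = 0]/([set 0] (j g)) -j0; exists g.
Qed.

Lemma aFIE_one_complemented (E G : normedModType K) (j : {linear G -> E}) :
  linear_isometry j -> aFIE E -> one_complemented (range j) -> aFIE G.
Proof.
move=> jI EE j1 eps X phi eps0 fdX phiI.
have [j0|jN0] := pselect (range j = [set 0]).
  exists 0; split; first exact/extend_trivial/(range_isometry_trivial jI).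
  by rewrite normr0 addr_ge0 ?ler01// ltW.
have [P [P1 rP Pid]] := one_complemented_bound j1 jN0.
have [T [TE Tle]] := aFIE_extend jI EE eps0 fdX phiI.
have [PT [PTE PTle]] := operator_comp P T.
have [|S [SE Sle]] := operator_factor (Q := PT) jI.
  by move=> _ [g _ <-]; rewrite PTE -rP; exists (T g).
exists S; split=> [x|].
  apply: (linear_isometry_inj jI); rewrite SE PTE TE Pid// inE.
  by exists (phi x).
rewrite (le_trans Sle)// (le_trans PTle)// (le_trans _ Tle)//.
by rewrite ler_piMl.
Qed.

Lemma operator_id (G : normedModType K) : [set: G] <> [set 0] ->
  exists I : operator G G, (forall x, I x = x) /\ `|I| = 1.
Proof.
move=> GN0; have lid : linear (idfun : G -> G) by [].
have [x|I [IE I1]] := operator_of_bound lid (ler01 : 0 <= 1 :> K).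
  by rewrite mul1r.
exists I; split=> [x|]; first by rewrite IE.
apply/le_anti; rewrite I1/=.
have /existsNP[g /eqP g0] : ~ forall g : G, g = 0.
  by move=> g0; apply: GN0; apply/seteqP; split=> // g _; exact: g0.
have := opnorm_le I g; rewrite IE/= -ler_pdivrMr ?normr_gt0//.
by rewrite divff// normr_eq0.
Qed.

Lemma FIE_bidual_complemented (E G : normedModType K) (j : {linear G -> E}) :
  linear_isometry j -> aFIE E ->
  one_complemented (@canonical_embedding R k E @` range j) -> FIE G.
Proof.
move=> jI EE Jj1 X phi fdX phiI.
have [G0|GN0] := pselect ([set: G] = [set 0]).
  by exists 0; split; [exact: extend_trivial|right].
have [X0|/existsNP[x0 /eqP x0N0]] := pselect (forall x : subspace_of X, x = 0).
  have [I [IE I1]] := operator_id GN0; exists I; split; last by left.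
  by move=> x; rewrite IE (X0 x) !raddf0.
pose J := @canonical_embedding R k E \o j.
have lJ : linear J.
  by move=> a x y; rewrite /J/= linearP; exact: canonical_embedding_linear.
pose JL : {linear G -> bidual E} :=
  HB.pack J (GRing.isLinear.Build _ _ _ _ J lJ).
have JI : linear_isometry JL.
  by move=> g; rewrite /= /J/= canonical_embedding_isometry jI.
have rJ : canonical_embedding (E := E) @` range j = range JL.
  by rewrite image_comp.
rewrite rJ in Jj1.
have [|P [P1 rP Pid]] := one_complemented_bound Jj1.
  by move=> /(range_isometry_trivial JI).
have /choice[T TP] (e : K) : exists T : operator G E, 0 < e ->
    (forall x : subspace_of X, T (val x) = j (phi x)) /\ `|T| <= 1 + e.
  (* [T] is total on [K]; [0] is a placeholder when [e] is not positive. *)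
  have [e0|] := pselect (0 < e); last by exists 0.
  by have [T ?] := aFIE_extend jI EE e0 fdX phiI; exists T.
have [|L [L1 LE]] := weak_star_limit (T := T); first by move=> e /TP[].
have [PL [PLE PLle]] := operator_comp P L.
have [|S [SE Sle]] := operator_factor (Q := PL) JI.
  by move=> _ [g _ <-]; rewrite PLE -rP; exists (L g).
(* All [T e] with [0 < e] agree on [X], so the limit is exact there, and [P] fixes its value. *)
have Sphi x : S (val x) = phi x.
  apply: (linear_isometry_inj JI); rewrite SE PLE (LE _ (j (phi x))).
    by rewrite Pid// inE; exists (phi x).
  by move=> e /TP[].
exists S; split=> //; left; apply/le_anti/andP; split.
  by rewrite (le_trans Sle)// (le_trans PLle)// mulr_ile1.
(* [S] preserves the norm of the nonzero [x0], so its own norm is at least 1. *)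
have := opnorm_le S (val x0); rewrite Sphi phiI -[`|val x0|]/(`|x0|).
by rewrite -ler_pdivrMr ?normr_gt0// divff// normr_eq0.
Qed.

End IsometricEmbedding.

Theorem proposition3p6 :
  forall (R : realType) (k : scalars),
  (forall (E : completeNormedModType (scalar_field R k)) (F : submodClosed E),
     (aFIE E -> one_complemented [set x : E | x \in F] ->
        aFIE (subspace_of F)) /\
     (aFIE E ->
        one_complemented (@canonical_embedding R k E @` [set x : E | x \in F]) ->
        FIE (subspace_of F))) /\
  (forall E : completeNormedModType (scalar_field R k),
     reflexive_space E -> aFIE E -> FIE E).
Proof.
move=> R k; split=> [E F|E rE EE].
  have FE : [set x : E | x \in F] = range (val : subspace_of F -> E).
    apply/seteqP; split=> [x xF|_ [x _ <-]]; last exact: (valP x).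
    by exists (Subspace_of xF).
  have valI : linear_isometry (val : {linear subspace_of F -> E}) by [].
  rewrite FE.
  by split; [exact: aFIE_one_complemented|exact: FIE_bidual_complemented].
(* With [j] the identity, reflexivity turns the image into the whole bidual, complemented by its
   identity operator, or by [0] when the bidual is zero. *)
apply: (FIE_bidual_complemented (j := idfun)) => //.
rewrite image_id rE.
have [B0|BN0] := pselect ([set: bidual E] = [set 0]).
  exists 0; split=> //; last by right.
  by rewrite B0; apply/seteqP; split=> [_ [x _ <-]//|_ ->]; exists 0.
have [I [IE I1]] := operator_id BN0.
exists I; split=> [v||]; [by rewrite IE| |by left].
by apply/seteqP; split=> // v _; exists v.
Qed.
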